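(* Fix a binary floating-point format with significand precision $p\ge 2$ bits, rounding to nearest with ties to even, and unit roundoff $u=2^{-p}$. Define $a=u/8$ and $X=8/u$, and assume that $a$ and $X$ are representable normal numbers. Consider the linear system $A=\operatorname{diag}(a,1)$, $b=(2,1)^T$, with starting vector $x_0=(X,0)^T$. Let $x_j$ and $r_j$ denote the stored iterate and stored residual generated by the floating-point steepest-descent algorithm with recursively updated residual (described in the context), with the operations evaluated in the displayed order. Then the iteration is well defined for every $j\ge 0$, and $$x_{2j}=(X,0)^T,\quad r_{2j}=(1,1)^T,\qquad x_{2j+1}=(X,2)^T,\quad r_{2j+1}=(1,-1)^T .$$ Furthermore, for all $j\ge 0$, $$r_j=b-Ax_j,\qquad \|b-Ax_j\|_2=\sqrt2,$$ where $b-Ax_j$ is evaluated in exact real arithmetic. Both residuals therefore have constant nonzero norm.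
   Context: The significand precision $p$ counts the bits of the binary significand including the leading bit. $\operatorname{fl}(\cdot)$ denotes the result of rounding (to nearest, ties to even) to a representable number; every scalar operation $+,-,\times,/$ is rounded individually and its result is stored before the next operation. Exact zero results are allowed. When $\operatorname{fl}$ is applied to a compound vector/matrix expression, every elementary scalar operation is rounded: products in vector updates are rounded before the following addition or subtraction; each matrix-vector product and each inner product is accumulated in increasing component order. Steepest descent with a recursively updated residual: set $r_0=\operatorname{fl}(b-Ax_0)$. For $j=0,1,\dots$: if $r_j=0$, return $x_j$; otherwise compute $$q_j=\operatorname{fl}(Ar_j),\quad a_j=\operatorname{fl}\!\left(\frac{\operatorname{fl}(\langle r_j,r_j\rangle)}{\operatorname{fl}(\langle q_j,r_j\rangle)}\right),\quad x_{j+1}=\operatorname{fl}(x_j+a_jr_j),\quad r_{j+1}=\operatorname{fl}(r_j-a_jq_j).$$ The step is defined when its denominator is nonzero. $\langle x,y\rangle=x^Ty$. *)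

(* Defs.v *)
From HB Require Import structures.
From mathcomp Require Import all_boot all_order all_algebra.
From mathcomp Require Import boolp classical_sets reals.

Set Implicit Arguments.
Unset Strict Implicit.
Unset Printing Implicit Defensive.

Import Order.TTheory GRing.Theory Num.Theory.
Local Open Scope ring_scope.

(* A binary format in the sense of IEEE 754, with gradual underflow: [emin] and
   [emax] bound the exponent of the leading bit of a normal number. *)
Record fpformat := FPFormat { prec : nat; emin : int; emax : int }.

(* [y] has the canonical representation m * 2^(e - p + 1). The integer
   significand [m] has exactly p bits unless e = emin, so that zero and the
   subnormals are represented only with e = emin. *)
Definition canonical_float (R : realType) (F : fpformat) (m e : int) (y : R)
    : Prop :=
  [/\ y = m%:~R * 2 ^ (e - (prec F)%:Z + 1),
      `|m| < 2 ^+ prec F,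
      emin F <= e <= emax F
    & (2 ^+ (prec F).-1 <= `|m|) || (e == emin F)].

Definition representable (R : realType) (F : fpformat) (y : R) : Prop :=
  exists m e : int, canonical_float F m e y.

Definition normal (R : realType) (F : fpformat) (y : R) : Prop :=
  exists m e : int, canonical_float F m e y /\ 2 ^+ (prec F).-1 <= `|m|.

Definition even_significand (R : realType) (F : fpformat) (y : R) : Prop :=
  exists m e : int, canonical_float F m e y /\ (2 %| m)%Z.

Definition nearest_even (R : realType) (F : fpformat) (x y : R) : Prop :=
  [/\ representable F y,
      forall z : R, representable F z -> `|x - y| <= `|x - z|
    & forall z : R, representable F z -> z != y -> `|x - z| = `|x - y| ->
        even_significand F y].

(* Rounding overflows from the midpoint between the largest finite number and
   2^(emax + 1) on. [None] stands for an operation with no finite result. For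
   prec F >= 2 and emin F <= emax F, [nearest_even F x] is a singleton below
   the threshold, and the default value 0 of [xget] is not used. *)
Definition fl (R : realType) (F : fpformat) (x : R) : option R :=
  if `|x| < 2 ^ emax F * (2 - 2 ^- prec F)
  then Some (xget 0 [set y | nearest_even F x y]) else None.

Definition fop (R : realType) (F : fpformat) (op : R -> R -> R)
    (x y : option R) : option R :=
  if (x, y) is (Some s, Some t) then fl F (op s t) else None.

Definition fadd (R : realType) (F : fpformat) (x y : option R) :=
  fop F (fun s t => s + t) x y.

Definition fsub (R : realType) (F : fpformat) (x y : option R) :=
  fop F (fun s t => s - t) x y.

Definition fmul (R : realType) (F : fpformat) (x y : option R) :=
  fop F (fun s t => s * t) x y.

(* In the field structure t / 0 = 0, hence the explicit test. *)
Definition fdiv (R : realType) (F : fpformat) (x y : option R) :=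
  if y == Some 0 then None else fop F (fun s t => s / t) x y.

Definition fsum (R : realType) (F : fpformat) (s : seq (option R)) : option R :=
  if s is y :: s' then foldl (fadd F) y s' else Some 0.

Definition fdot (R : realType) (F : fpformat) (n : nat)
    (x y : 'cV[option R]_n) : option R :=
  fsum F [seq fmul F (x i 0) (y i 0) | i <- enum 'I_n].

Definition fmulmx (R : realType) (F : fpformat) (n : nat)
    (A : 'M[option R]_n) (x : 'cV[option R]_n) : 'cV[option R]_n :=
  \col_i fsum F [seq fmul F (A i j) (x j 0) | j <- enum 'I_n].

Definition stored (R : realType) (m n : nat) (A : 'M[R]_(m, n))
    : 'M[option R]_(m, n) := map_mx Some A.

Inductive sd_state (R : realType) (n : nat) : Type :=
| Iterating of 'cV[option R]_n & 'cV[option R]_n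
| Returned of 'cV[option R]_n.

Definition sd_init (R : realType) (F : fpformat) (n : nat)
    (A : 'M[R]_n) (b x0 : 'cV[R]_n) : sd_state R n :=
  let y := fmulmx F (stored A) (stored x0) in
  Iterating (stored x0) (\col_i fsub F (Some (b i 0)) (y i 0)).

Definition sd_step (R : realType) (F : fpformat) (n : nat)
    (A : 'M[R]_n) (s : sd_state R n) : sd_state R n :=
  match s with
  | Iterating x r =>
      if r == stored 0 then Returned x else
      let q := fmulmx F (stored A) r in
      let alpha := fdiv F (fdot F r r) (fdot F q r) in
      Iterating (\col_i fadd F (x i 0) (fmul F alpha (r i 0)))
                (\col_i fsub F (r i 0) (fmul F alpha (q i 0)))
  | Returned x => Returned x
  end.

(* [Iterating x r] at index j means x_j = x and r_j = r; [Returned _] means that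
   the algorithm has returned at an earlier index. *)
Definition steepest_descent (R : realType) (F : fpformat) (n : nat)
    (A : 'M[R]_n) (b x0 : 'cV[R]_n) (j : nat) : sd_state R n :=
  iter j (sd_step F A) (sd_init F A b x0).

Definition norm2 (R : realType) (n : nat) (v : 'cV[R]_n) : R :=
  Num.sqrt (\sum_i v i 0 ^+ 2).

Definition col2 (R : realType) (c d : R) : 'cV[R]_2 :=
  \col_(i < 2) (if i == 0 then c else d).

(* Main.v *)
(** Just below a power of two the spacing of the format is half of what it is
    just above, so a perturbation of less than a quarter of the latter is rounded
    away, whatever its sign. This gives fl(1 + a) = 1, fl(1 - 2a) = 1 and
    fl(X + 2) = X; moreover a X = 1, and all other operations are exact. Hence
    every step length is 2, and the iteration alternately adds and subtracts 2 in
    the second component of the iterate, while X and the first residual component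
    do not move. *)

Require Import Defs.
From HB Require Import structures.
From mathcomp Require Import all_boot all_order all_algebra.
From mathcomp Require Import boolp classical_sets reals.
From mathcomp Require Import ring lra zify.

Set Implicit Arguments.
Unset Strict Implicit.
Unset Printing Implicit Defensive.

Import Order.TTheory GRing.Theory Num.Theory.
Local Open Scope ring_scope.

(** * Magnitude and exponent of canonical floats *)

Section Rounding.
Variables (R : realType) (F : fpformat).
Implicit Types (x y z d : R) (m e k : int).

Let exp2D k m : 2 ^ (k + m) = 2 ^ k * 2 ^ m :> R.
Proof. by rewrite expfzDr ?pnatr_eq0. Qed.

Lemma canonical_float_lt m e y : canonical_float F m e y -> `|y| < 2 ^ (e + 1).
Proof.
case=> -> m_lt _ _.
have -> : e + 1 = (prec F)%:Z + (e - (prec F)%:Z + 1) by lia.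
rewrite [ltRHS]exp2D normrM (gtr0_norm (exprz_gt0 _ _)) //.
rewrite ltr_pM2r ?exprz_gt0 // -intr_norm -exprnP.
by rewrite -(ltr_int R) rmorphXn in m_lt.
Qed.

Lemma canonical_float_ge m e y : (0 < prec F)%N ->
  canonical_float F m e y -> 2 ^+ (prec F).-1 <= `|m| -> 2 ^ e <= `|y|.
Proof.
move=> p_gt0 [-> _ _ _] m_ge.
have -> : e = (prec F).-1%:Z + (e - (prec F)%:Z + 1) by lia.
rewrite [leLHS]exp2D normrM (gtr0_norm (exprz_gt0 _ _)) //.
have -> : (prec F).-1%:Z + (e - (prec F)%:Z + 1) - (prec F)%:Z + 1 =
  e - (prec F)%:Z + 1 by lia.
rewrite ler_pM2r ?exprz_gt0 // -intr_norm -exprnP.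
by rewrite -(ler_int R) rmorphXn in m_ge.
Qed.

(** A significand of exactly p bits gives 2^e <= |y| < 2^(e+1), and for y = 2^k this forces e = k.
    This turns normality of [a] and [X] into bounds on the exponent range. *)
Lemma normal_exp2 k : (0 < prec F)%N -> normal F (2 ^ k : R) ->
  emin F <= k <= emax F.
Proof.
move=> p_gt0 [m [e [can_k m_ge]]].
have := canonical_float_lt can_k; have := canonical_float_ge p_gt0 can_k m_ge.
rewrite gtr0_norm ?exprz_gt0 // ler_eXz2l ?ltr_eXz2l ?ltr1n //.
by case: can_k => _ _ /andP[? ?] _; lia.
Qed.

(** * Representable numbers and rounding, in particular near powers of two *)

Lemma representableN y : representable F y -> representable F (- y).
Proof.
move=> [m [e [-> m_lt e_bnd m_ge]]]; exists (- m), e.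
by split; rewrite ?normrN // rmorphN mulNr.
Qed.

Lemma representable0 : emin F <= emax F -> representable F (0 : R).
Proof.
move=> e_le; exists 0, (emin F).
by split; rewrite ?mul0r ?normr0 ?exprn_gt0 ?lexx ?eqxx ?orbT.
Qed.

Lemma representable_exp2 k : (0 < prec F)%N -> emin F <= k <= emax F ->
  representable F (2 ^ k : R).
Proof.
move=> p_gt0 k_bnd; exists (2 ^+ (prec F).-1), k; split => //.
- rewrite rmorphXn /= exprnP -exp2D; by congr (_ ^ _); lia.
- by rewrite normrX ltr_eXn2l // prednK.
- by rewrite normrX lexx.
Qed.

(** The largest finite number (2^p - 1) 2^(emax - p + 1) lies half a spacing, 2^(emax - p), below
    the overflow threshold. *)
Lemma representable_lt y : representable F y ->
  `|y| < 2 ^ emax F * (2 - 2 ^- prec F).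
Proof.
move=> [m [e [-> m_lt /andP[_ e_le] _]]].
have m_le : `|m| <= 2 ^+ prec F - 1 by lia.
rewrite -(ler_int R) rmorphB rmorphXn intr_norm /= in m_le.
rewrite normrM (gtr0_norm (exprz_gt0 _ _)) //.
apply: (@le_lt_trans _ _ ((2 ^+ prec F - 1) * 2 ^ (emax F - (prec F)%:Z + 1))).
  by apply: ler_pM => //; rewrite ?exprz_ge0 // ler_eXz2l ?ltr1n // lerD2r lerB.
rewrite !exp2D -invr_expz -exprnP.
set P : R := 2 ^+ _; set E : R := 2 ^ _.
have P_gt0 : 0 < P by rewrite exprn_gt0.
have E_gt0 : 0 < E by rewrite exprz_gt0.
rewrite -subr_gt0.
have -> : E * (2 - P^-1) - (P - 1) * (E * P^-1 * 2 ^ 1) = E / P.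
  by rewrite expr1z; field; rewrite gt_eqF.
by rewrite divr_gt0.
Qed.

(** A strictly nearest float leaves no ties, so the parity clause is vacuous and the set given to
    [xget] is a singleton. *)
Lemma fl_eq x y : `|x| < 2 ^ emax F * (2 - 2 ^- prec F) -> representable F y ->
  (forall z, representable F z -> z != y -> `|x - y| < `|x - z|) ->
  fl F x = Some y.
Proof.
move=> x_lt rep_y near_y; rewrite /fl x_lt; congr Some.
apply: xget_unique => [|z [rep_z near_z _]].
  split=> // z rep_z; last by move=> /(near_y z rep_z) + eq_d; rewrite eq_d ltxx.
  by have [->//|/(near_y z rep_z)/ltW] := eqVneq z y.
apply/eqP; apply: contraT => /(near_y z rep_z).
by rewrite ltNge near_z.
Qed.

Lemma fl_representable y : representable F y -> fl F y = Some y.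
Proof.
move=> rep_y; apply: fl_eq => // [|z _ neq_zy]; first exact: representable_lt.
by rewrite subrr normr0 normr_gt0 subr_eq0 eq_sym.
Qed.

(** The bound is the spacing just below 2^k. If e > k, then z is normal because e > emin, and |z| >=
    2^(k+1); if e < k - 1, then |z| < 2^(k-1); in both cases z is far away. For e = k - 1 or e = k,
    z and 2^k are distinct multiples of 2^(e-p+1) >= 2^(k-p). *)
Lemma representable_gap_exp2 k z : (0 < prec F)%N -> emin F <= k ->
  representable F z -> z != 2 ^ k -> 2 ^ (k - (prec F)%:Z) <= `|z - 2 ^ k|.
Proof.
move=> p_gt0 k_ge [m [e can_z]] neq_zk.
have K_gt0 : 0 < 2 ^ k :> R by rewrite exprz_gt0.
have [e_gt|e_le] := ltP k e.
  have m_ge : 2 ^+ (prec F).-1 <= `|m|.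
    by case: can_z => _ _ _ /orP[//|/eqP e_min]; lia.
  have z_ge := canonical_float_ge p_gt0 can_z m_ge.
  have : 2 ^ (k + 1) <= `|z|.
    by apply: le_trans z_ge; rewrite ler_eXz2l ?ltr1n; lia.
  have : 2 ^ (k - (prec F)%:Z) <= 2 ^ k :> R.
    by rewrite ler_eXz2l ?ltr1n; lia.
  rewrite (exp2D k 1) expr1z => ? ?.
  by have := lerB_dist z (2 ^ k); rewrite (gtr0_norm K_gt0); lra.
have [e_lt|e_ge] := ltP e (k - 1).
  have z_lt := canonical_float_lt can_z.
  have : 2 ^ (e + 1) <= 2 ^ (k - 1) :> R.
    by rewrite ler_eXz2l ?ltr1n; lia.
  have : 2 ^ (k - (prec F)%:Z) <= 2 ^ (k - 1) :> R.
    by rewrite ler_eXz2l ?ltr1n; lia.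
  have -> : 2 ^ (k - 1) = 2 ^ k / 2 :> R by rewrite exp2D exprN1.
  move=> ? ?.
  by have := lerB_dist (2 ^ k) z; rewrite (gtr0_norm K_gt0) distrC; lra.
case: can_z neq_zk => -> _ _ _.
(* 2^k is 2^N units of size 2^(e-p+1). The exponent is nonnegative because e <= k and p > 0, so
   [absz] changes nothing. *)
pose N : nat := absz (k - e + (prec F)%:Z - 1)%R.
have -> : k = N%:Z + (e - (prec F)%:Z + 1) by rewrite /N; lia.
move=> neq_zk.
rewrite [X in `|_ - X|]exp2D -mulrBl normrM (gtr0_norm (exprz_gt0 _ _)) //.
apply: (@le_trans _ _ (2 ^ (e - (prec F)%:Z + 1))).
  by rewrite ler_eXz2l ?ltr1n // /N; lia.
rewrite ler_peMl ?exprz_ge0 //.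
have neq_mN : m != 2 ^+ N.
  apply: contra neq_zk => /eqP ->.
  by rewrite rmorphXn [X in _ == X]exp2D.
have : 1 <= `|m - 2 ^+ N| by lia.
by rewrite -(ler_int R) intr_norm rmorphB rmorphXn.
Qed.

(** The perturbation is below half the smallest gap around 2^k, so by the triangle inequality every
    other float is farther away. *)
Lemma fl_exp2D k d : (1 < prec F)%N -> emin F <= k <= emax F ->
  `|d| < 2 ^ (k - (prec F)%:Z - 1) -> fl F (2 ^ k + d) = Some (2 ^ k).
Proof.
move=> p_gt1 /andP[k_ge k_le] d_lt.
have p_gt0 : (0 < prec F)%N by lia.
have gap_eq : 2 ^ (k - (prec F)%:Z) = 2 * 2 ^ (k - (prec F)%:Z - 1) :> R.
  by rewrite -[X in X * _]expr1z -exp2D; congr (_ ^ _); lia.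
apply: fl_eq => [||z rep_z neq_zk].
(* No overflow, even for k = emax: the argument is below 5/4 of 2^emax, the threshold at least 3/2
   of it. *)
- have K_gt0 : 0 < 2 ^ k :> R by rewrite exprz_gt0.
  have KE : 2 ^ k <= 2 ^ emax F :> R by rewrite ler_eXz2l ?ltr1n.
  have : 2 ^ (k - (prec F)%:Z - 1) <= 2 ^ (k - 1 - 1) :> R.
    by rewrite ler_eXz2l ?ltr1n; lia.
  rewrite [leRHS]exp2D [X in _ <= X * _]exp2D !exprN1 => d_le.
  have : 2 ^- prec F <= 2 ^- 1 :> R.
    by rewrite lef_pV2 ?posrE ?exprn_gt0 // ler_eXn2l ?ltr1n.
  rewrite expr1 => u_le.
  have : `|2 ^ k + d| <= 2 ^ k + `|d|.
    by rewrite (le_trans (ler_normD _ _)) // (gtr0_norm K_gt0).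
  have : 2 ^ emax F * (2 - 2^-1) <= 2 ^ emax F * (2 - 2 ^- prec F) :> R.
    by rewrite ler_pM2l ?exprz_gt0 //; lra.
  lra.
- exact: representable_exp2 p_gt0 (introT andP (conj k_ge k_le)).
have := representable_gap_exp2 p_gt0 k_ge rep_z neq_zk.
have := lerB_dist (z - 2 ^ k) d.
have -> : z - 2 ^ k - d = - (2 ^ k + d - z) by ring.
have -> : 2 ^ k + d - 2 ^ k = d by ring.
rewrite normrN gap_eq; lra.
Qed.

(** * Two-dimensional vectors and diagonal matrices *)

Lemma enum_ord2 : enum 'I_2 = [:: 0; 1].
Proof. by apply: (inj_map val_inj); rewrite val_enum_ord. Qed.

Lemma fdot2 (x y : 'cV[option R]_2) :
  fdot F x y = fadd F (fmul F (x 0 0) (y 0 0)) (fmul F (x 1 0) (y 1 0)).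
Proof. by rewrite /fdot enum_ord2. Qed.

Lemma diag_mx_col2 (l m c d : R) :
  diag_mx (col2 l m)^T *m col2 c d = col2 (l * c) (m * d).
Proof.
apply/matrixP => i j; rewrite mul_diag_mx !mxE.
by case: ifP.
Qed.

(** The off-diagonal products are exact zeros and adding them is exact, so rounding can only occur
    in the two diagonal products. *)
Lemma fmulmx_diag_col2 (l m c d : R) : representable F (0 : R) ->
  representable F (l * c) -> representable F (m * d) ->
  fmulmx F (stored (diag_mx (col2 l m)^T)) (stored (col2 c d)) =
  stored (col2 (l * c) (m * d)).
Proof.
move=> rep0 rep_lc rep_md; apply/matrixP => i j.
rewrite !mxE enum_ord2 /= !mxE /=.
have [-> | ->] : i = 0 \/ i = 1.
  by case: i => [[|[|//]] lt_i]; [left | right]; apply: val_inj.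
  rewrite /= mulr1n mulr0n /fmul /fadd /fop mul0r.
  rewrite fl_representable // fl_representable //.
  by rewrite addr0 fl_representable.
rewrite /= mulr1n mulr0n /fmul /fadd /fop mul0r.
rewrite fl_representable // fl_representable //.
by rewrite add0r fl_representable.
Qed.

Lemma norm2_col2 (c d : R) : norm2 (col2 c d) = Num.sqrt (c ^+ 2 + d ^+ 2).
Proof. by rewrite /norm2 big_ord_recl big_ord1 !mxE. Qed.

Lemma col2_neq0 (c d : R) : c != 0 -> col2 c d != 0.
Proof.
by apply: contraNneq => /matrixP/(_ 0 0); rewrite !mxE /= => ->.
Qed.

Lemma stored_neq0 n (v : 'cV[R]_n) : v != 0 -> (stored v == stored 0) = false.
Proof.
move=> v_neq0; apply: contra_neqF v_neq0 => /eqP/matrixP eq_v0.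
by apply/matrixP => i j; have := eq_v0 i j; rewrite !mxE => -[].
Qed.

Lemma subr_col2 (c d c' d' : R) :
  col2 c d - col2 c' d' = col2 (c - c') (d - d').
Proof. by apply/matrixP => i j; rewrite !mxE; case: ifP. Qed.

End Rounding.

(** * The two-periodic orbit *)

Section Oscillation.
Variables (R : realType) (F : fpformat).
Hypotheses (p_gt1 : (1 < prec F)%N)
  (emin_le : emin F <= - (prec F)%:Z - 3) (le_emax : (prec F)%:Z + 3 <= emax F).

Let u : R := 2 ^- prec F.
Let a : R := u / 8.
Let X : R := 8 / u.
Let A : 'M[R]_2 := diag_mx (col2 a 1)^T.
(** The boolean is the parity of the index; coerced to a natural number it makes [2 *+ b] equal to 0
    or 2. *)
Let x (b : bool) : 'cV[R]_2 := col2 X (2 *+ b).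
Let r (b : bool) : 'cV[R]_2 := col2 1 ((-1) ^+ b).

Let exp2_3 : 2 ^ 3%:Z = 8 :> R.
Proof. by rewrite -exprnP; ring. Qed.

Lemma unit_roundoff_div8E : a = 2 ^ (- (prec F)%:Z - 3).
Proof.
by rewrite /a -exp2_3 /u exprnP !invr_expz -expfzDr ?pnatr_eq0.
Qed.

Lemma div8_unit_roundoffE : X = 2 ^ ((prec F)%:Z + 3).
Proof.
by rewrite /X -exp2_3 invrK mulrC exprnP -expfzDr ?pnatr_eq0.
Qed.

Let aX : a * X = 1.
Proof. by rewrite /a /X; field; rewrite invr_eq0 expf_eq0 pnatr_eq0 andbF. Qed.

Let rep_exp2 k : - (prec F)%:Z - 3 <= k <= (prec F)%:Z + 3 ->
  representable F (2 ^ k : R).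
Proof. by move=> k_bnd; apply: representable_exp2; lia. Qed.

Let rep0 : representable F (0 : R).
Proof. by apply: representable0; lia. Qed.

Let rep1 : representable F (1 : R).
Proof. by rewrite -(expr0z 2); apply: rep_exp2; lia. Qed.

Let rep2 : representable F (2 : R).
Proof. by rewrite -(expr1z 2); apply: rep_exp2; lia. Qed.

Let repa : representable F a.
Proof. by rewrite unit_roundoff_div8E; apply: rep_exp2; lia. Qed.

Let rep2a : representable F (2 * a).
Proof.
rewrite unit_roundoff_div8E -[X in X * _]expr1z -expfzDr ?pnatr_eq0 //.
by apply: rep_exp2; lia.
Qed.

Let rep_sign (b : bool) : representable F ((-1) ^+ b : R).
Proof. by case: b; rewrite /= ?expr0 ?expr1 //; apply: representableN. Qed.

Let rep_2sign (b : bool) : representable F (2 * (-1) ^+ b : R).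
Proof.
by case: b; rewrite /= ?expr0 ?expr1 ?mulrN mulr1 //; apply: representableN.
Qed.

(** In this and the next two facts, [fl_exp2D] allows perturbations below 2^(-p-1) at 1 (k = 0) and
    below 4 at [X] (k = p + 3). The actual ones are a = 2^(-p-3), 2a = 2^(-p-2) and 2. *)
Let fl1Da : fl F (1 + a) = Some 1.
Proof.
rewrite -(expr0z 2); apply: fl_exp2D => //; first by lia.
by rewrite unit_roundoff_div8E gtr0_norm ?exprz_gt0 // ltr_eXz2l ?ltr1n; lia.
Qed.

Let fl1B2a : fl F (1 - 2 * a) = Some 1.
Proof.
rewrite -(expr0z 2); apply: fl_exp2D => //; first by lia.
rewrite expr0z unit_roundoff_div8E -[X in X * _]expr1z -expfzDr ?pnatr_eq0 //.
by rewrite normrN gtr0_norm ?exprz_gt0 // ltr_eXz2l ?ltr1n; lia.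
Qed.

Let flXD2 : fl F (X + 2) = Some X.
Proof.
rewrite div8_unit_roundoffE; apply: fl_exp2D => //; first by lia.
by rewrite gtr0_norm // -[ltLHS]expr1z ltr_eXz2l ?ltr1n; lia.
Qed.

Lemma fmulmx_residual (b : bool) :
  fmulmx F (stored A) (stored (r b)) = stored (col2 a ((-1) ^+ b)).
Proof. by rewrite fmulmx_diag_col2 ?mulr1 ?mul1r. Qed.

Lemma fdot_residual b : fdot F (stored (r b)) (stored (r b)) = Some 2.
Proof.
rewrite fdot2 !mxE /fmul /fop /= mul1r -expr2 sqrr_sign !fl_representable //.
by rewrite /fadd /fop fl_representable.
Qed.

(** The exact value is a + 1 for either sign, and [a] is absorbed. *)
Lemma fdot_denominator (b : bool) :
  fdot F (stored (col2 a ((-1) ^+ b))) (stored (r b)) = Some 1.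
Proof.
rewrite fdot2 !mxE /fmul /fop /= mulr1 -expr2 sqrr_sign !fl_representable //.
by rewrite /fadd /fop addrC.
Qed.

Lemma sd_init_col2 : sd_init F A (col2 2 1) (x false) =
  Iterating (stored (x false)) (stored (r false)).
Proof.
rewrite /sd_init fmulmx_diag_col2 ?aX ?mul1r //; congr Iterating.
apply/matrixP => i j; rewrite !mxE /fsub /fop.
have e1 : 2 - 1 = 1 :> R by ring.
by case: ifP; rewrite ?e1 ?subr0 fl_representable.
Qed.

Lemma sd_step_col2 b :
  sd_step F A (Iterating (stored (x b)) (stored (r b))) =
  Iterating (stored (x (~~ b))) (stored (r (~~ b))).
Proof.
rewrite /sd_step stored_neq0 ?col2_neq0 ?oner_neq0 //.
rewrite fmulmx_residual fdot_residual fdot_denominator.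
have -> : fdiv F (Some 2) (Some 1) = Some (2 : R).
  rewrite /fdiv /fop ifF ?divr1 ?fl_representable //.
  by apply/eqP => -[/eqP]; rewrite oner_eq0.
have rep_x : representable F (2 *+ ~~ b : R) by case: b.
have eq_x : 2 *+ b + 2 * (-1) ^+ b = 2 *+ ~~ b :> R.
  by case: (b) => /=; ring.
have eq_r : (-1) ^+ b - 2 * (-1) ^+ b = (-1) ^+ (~~ b) :> R.
  by case: (b) => /=; ring.
congr Iterating; apply/matrixP => i j; rewrite !mxE /fmul /fop /=.
  (* Absorption by [flXD2] settles the first component of the iterate; the second is exact. *)
  case: ifP => _; rewrite ?mulr1 fl_representable // /fadd /fop.
  by rewrite eq_x fl_representable.
(* Likewise [fl1B2a] settles the first component of the residual. *)
case: ifP => _; rewrite fl_representable // /fsub /fop.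
by rewrite eq_r fl_representable.
Qed.

(** The two absorbed updates match: the iterate loses 2 in its first component, which [A] maps to
    2a, exactly what the recursive residual loses. Hence the stored residual does not drift from the
    true one. *)
Lemma exact_residual b : r b = col2 2 1 - A *m x b.
Proof.
rewrite diag_mx_col2 aX subr_col2 /r; congr col2; first by ring.
by case: b => /=; ring.
Qed.

Lemma norm2_residual b : norm2 (r b) = Num.sqrt 2.
Proof. by rewrite norm2_col2 expr1n sqrr_sign. Qed.

Lemma steepest_descentE j : steepest_descent F A (col2 2 1) (x false) j =
  Iterating (stored (x (odd j))) (stored (r (odd j))).
Proof.
elim: j => [|j IHj]; first exact: sd_init_col2.
rewrite /steepest_descent iterS -/(steepest_descent _ _ _ _ _) IHj.
exact: sd_step_col2.
Qed.

End Oscillation.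

Theorem theorem1 (R : realType) (F : fpformat) (hp : (2 <= prec F)%N) :
  let u : R := 2 ^- prec F in
  let a : R := u / 8 in
  let X : R := 8 / u in
  normal F a -> normal F X ->
  let A : 'M[R]_2 := diag_mx (col2 a 1)^T in
  let b : 'cV[R]_2 := col2 2 1 in
  let x0 : 'cV[R]_2 := col2 X 0 in
  exists x r : nat -> 'cV[R]_2,
  [/\ forall j : nat,
        steepest_descent F A b x0 j = Iterating (stored (x j)) (stored (r j)),
      forall j : nat,
        r j != 0 /\
        exists d : R,
          fdot F (fmulmx F (stored A) (stored (r j))) (stored (r j)) = Some d
          /\ d != 0,
      forall j : nat,
        [/\ x (2 * j)%N = col2 X 0, r (2 * j)%N = col2 1 1,
            x (2 * j + 1)%N = col2 X 2 & r (2 * j + 1)%N = col2 1 (-1)]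
    & forall j : nat,
        [/\ r j = b - A *m x j,
            norm2 (b - A *m x j) = Num.sqrt 2
          & norm2 (r j) = Num.sqrt 2]].
Proof.
move=> u a X a_normal X_normal A b x0.
have p_gt0 : (0 < prec F)%N by lia.
(* [a] and [X] are the powers of two with exponents -p - 3 and p + 3; their normality bounds the
   range from below and from above. *)
have /andP[emin_le _] : emin F <= - (prec F)%:Z - 3 <= emax F.
  by apply: (@normal_exp2 R) p_gt0 _; rewrite -unit_roundoff_div8E.
have /andP[_ le_emax] : emin F <= (prec F)%:Z + 3 <= emax F.
  by apply: (@normal_exp2 R) p_gt0 _; rewrite -div8_unit_roundoffE.
exists (fun j => col2 X (2 *+ odd j)), (fun j => col2 1 ((-1) ^+ odd j)).
split=> j.
- exact: steepest_descentE.
- split; first by rewrite col2_neq0 ?oner_neq0.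
  (* The computed denominator is fl(a + 1) = 1 at every index. *)
  exists 1; split; last exact: oner_neq0.
  by rewrite fmulmx_residual // fdot_denominator.
- by rewrite addn1 /= mul2n odd_double /= expr0 expr1.
- by rewrite -(exact_residual R F) norm2_residual.
Qed.
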